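(* Let $n \ge 2$. For all $t$ with $1 \le t \le n$, the landing vector $L_t$ of the $n$-player collaboration chain is the normalization of $\mathbf{u}_t$, that is, $$L_t = \frac{1}{\mathbf{u}_t \mathbf{1}}\, \mathbf{u}_t .$$
   Context: The chain: there are $n$ players, each initially on a different team (so $n$ teams of size 1). At each time step an ordered pair (winner, loser) of distinct players is chosen uniformly at random among the $n(n-1)$ such pairs, independently of the past; the loser leaves his or her team and joins the winner's team (nothing changes if they are already on the same team). The state of the system is the partition of $n$ given by the multiset of sizes of the nonempty teams; this is a Markov chain on the set of partitions of $n$. A partition is written in vector notation $\mathbf{r} = (r_1, r_2, \dots, r_k)$, where $r_i$ is the number of parts of size $i$, so $\sum_i i r_i = n$. Let $S(n,t)$ be the set of partitions of $n$ into exactly $t$ parts (with some fixed ordering); these are the states of ''Stage $t$''. The number of parts never increases and decreases by at most 1 in each step. Landing vectors: these are row vectors indexed by $S(n,t)$, defined recursively downward in $t$. Set $L_n := (1)$ (the single state of Stage $n$ is the partition with $n$ parts of size 1). For $n \ge t \ge 2$, suppose the chain starts in one of the states of Stage $t$ with probabilities given by the entries of $L_t$; then $L_{t-1}$ is the row vector whose entry at a state $\mathbf{s} \in S(n,t-1)$ is the probability that the first state of Stage $t-1$ reached by the chain is $\mathbf{s}$. The vectors $\mathbf{u}_t$: for $\mathbf{r} = (r_1,\dots,r_k) \in S(n,t)$ put $m_{\mathbf{r}} := \frac{t!}{r_1! r_2! \cdots r_k!}$, and let $\mathbf{u}_t$ be the row vector indexed by $S(n,t)$ whose entry at $\mathbf{r}$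 is $m_{\mathbf{r}}$. $\mathbf{1}$ denotes the column vector of ones of appropriate length, so $\mathbf{u}_t\mathbf{1} = \sum_{\mathbf{r}\in S(n,t)} m_{\mathbf{r}}$. *)

(* Defs.v *)
From HB Require Import structures.
From mathcomp Require Import all_boot all_order all_fingroup all_algebra.
From mathcomp Require Import all_classical all_reals all_analysis.

Set Implicit Arguments.
Unset Strict Implicit.
Unset Printing Implicit Defensive.

Import Order.TTheory GRing.Theory Num.Theory.
Import numFieldNormedType.Exports.

Local Open Scope ring_scope.

(* Vector notation for partitions: [r i] is the number of parts of size i.+1. *)
Definition is_intpart (n : nat) (r : {ffun 'I_n -> 'I_n.+1}) : bool :=
  (\sum_(i < n) i.+1 * r i == n)%N.

Notation intpart n := {r : {ffun 'I_n -> 'I_n.+1} | is_intpart r}.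

Definition mult (n : nat) (r : intpart n) (i : 'I_n) : nat := val r i.

Definition nparts (n : nat) (r : intpart n) : nat := (\sum_(i < n) mult r i)%N.

(* Row vectors indexed by [stage n t] use the ordering given by [enum_val]. *)
Definition stage (n t : nat) : {set intpart n} :=
  [set r : intpart n | nparts r == t].

(* Teams of labelled players: player x is on the team labelled [A x].  The n
   labels suffice, since there are never more than n nonempty teams. *)
Notation config n := {ffun 'I_n -> 'I_n}.

Definition team_size (n : nat) (A : config n) (j : 'I_n) : nat :=
  #|[set x : 'I_n | A x == j]|.

(* [wl] is the pair (winner, loser). *)
Definition play (n : nat) (A : config n) (wl : 'I_n * 'I_n) : config n :=
  [ffun x => if x == wl.2 then A wl.1 else A x].

Definition state_vec (n : nat) (A : config n) : {ffun 'I_n -> 'I_n.+1} :=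
  [ffun i : 'I_n => inord #|[set j : 'I_n | team_size A j == i.+1]|].

Lemma state_vecE (n : nat) (A : config n) (i : 'I_n) :
  state_vec A i = #|[set j : 'I_n | team_size A j == i.+1]| :> nat.
Proof.
rewrite ffunE inordK // ltnS; apply: leq_trans (max_card _) _.
by rewrite card_ord.
Qed.

Lemma team_size_le (n : nat) (A : config n) (j : 'I_n) : (team_size A j <= n)%N.
Proof. by apply: leq_trans (max_card _) _; rewrite card_ord. Qed.

Lemma sum_team_size (n : nat) (A : config n) : (\sum_(j < n) team_size A j = n)%N.
Proof.
transitivity (\sum_(x < n) 1)%N; last by rewrite sum1_card card_ord.
rewrite [RHS](partition_big (fun x : 'I_n => A x) xpredT) //=.
apply: eq_bigr => j _; rewrite /team_size -sum1_card.
by apply: eq_bigl => x; rewrite inE.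
Qed.

Lemma state_vec_intpart (n : nat) (A : config n) : is_intpart (state_vec A).
Proof.
apply/eqP; rewrite -[RHS](sum_team_size A).
transitivity (\sum_(i < n) \sum_(j < n | team_size A j == i.+1) i.+1)%N.
  apply: eq_bigr => i _; rewrite state_vecE mulnC -sum_nat_const.
  by apply: eq_bigl => j; rewrite inE.
rewrite (exchange_big_dep xpredT) //=; apply: eq_bigr => j _.
case E: (team_size A j) => [|m]; first by rewrite big_pred0_eq.
have lt_mn : (m < n)%N by rewrite -E team_size_le.
by rewrite (big_pred1 (Ordinal lt_mn)) // => i; rewrite eqSS eq_sym.
Qed.

(* The state of the system: the multiset of sizes of the nonempty teams. *)
Definition state_of (n : nat) (A : config n) : intpart n :=
  exist _ (state_vec A) (state_vec_intpart A).

(* The parts of [r] as a weakly increasing sequence. *)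
Definition parts (n : nat) (r : intpart n) : seq nat :=
  flatten [seq nseq (mult r i) i.+1 | i <- enum 'I_n].

(* A configuration in state [r]: the players, in increasing order, fill
   consecutive teams of the sizes listed in [parts r].  The default value of
   [insubd] is never used. *)
Definition config_of (n : nat) (r : intpart n) : config n :=
  [ffun x : 'I_n => insubd x (reshape_index (parts r) x)].

Definition trans (R : realType) (n : nat) (r s : intpart n) : R :=
  #|[set wl : 'I_n * 'I_n | (wl.1 != wl.2) &&
       (state_of (play (config_of r) wl) == s)]|%:R
  / #|[set wl : 'I_n * 'I_n | wl.1 != wl.2]|%:R.

Section Lumpability.
Variable n : nat.

Lemma sumn_parts (r : intpart n) : sumn (parts r) = n.
Proof.
rewrite /parts sumn_flatten -map_comp sumnE big_map big_enum /=.
rewrite -[RHS](eqP (valP r)); apply: eq_bigr => i _.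
by rewrite sumn_nseq.
Qed.

Lemma count_parts (r : intpart n) (i : 'I_n) :
  count_mem i.+1 (parts r) = mult r i.
Proof.
rewrite /parts count_flatten -map_comp sumnE big_map big_enum /=.
rewrite (bigD1 i) //= count_nseq /= eqxx mul1n big1 ?addn0 // => j ji.
by rewrite count_nseq /= eqSS val_eqE (negPf ji).
Qed.

Lemma parts_gt0 (r : intpart n) : all (leq 1) (parts r).
Proof.
apply/allP => m /flattenP[s /mapP[i _ ->]].
by rewrite mem_nseq => /andP[_ /eqP->].
Qed.

Lemma size_parts (r : intpart n) : (size (parts r) <= n)%N.
Proof.
rewrite -[X in (_ <= X)%N](sumn_parts r).
by elim: (parts r) (parts_gt0 r) => //= m s IH /andP[m0 /IH]; rewrite -add1n; apply: leq_add.
Qed.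

Lemma val_config_of (r : intpart n) (x : 'I_n) :
  config_of r x = reshape_index (parts r) x :> nat.
Proof.
rewrite ffunE val_insubd ifT //; apply: leq_trans (size_parts r).
by apply: reshape_indexP; rewrite sumn_parts.
Qed.

Lemma team_size_config_of (r : intpart n) (j : 'I_n) :
  team_size (config_of r) j = nth 0%N (parts r) j.
Proof.
set sh := parts r; set m := nth _ _ _.
have lt_fl (c : 'I_m) : (flatten_index sh j c < n)%N.
  by rewrite -[X in (_ < X)%N](sumn_parts r); apply: flatten_indexP.
pose f (c : 'I_m) := Ordinal (lt_fl c).
have f_inj : injective f.
  move=> c d /(congr1 val) /= /(congr1 (reshape_offset sh)).
  by rewrite !flatten_indexKr // => /val_inj.
rewrite -[RHS]card_ord -(card_imset _ f_inj) /team_size; congr #|pred_of_set _|.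
apply/setP => x; rewrite inE; apply/eqP/imsetP.
  move=> Ax; have Ej : reshape_index sh x = j by rewrite -val_config_of Ax.
  have ltx : (x < sumn sh)%N by rewrite sumn_parts.
  have := reshape_offsetP ltx; rewrite Ej => ltm.
  exists (Ordinal ltm) => //; apply: val_inj => /=.
  by rewrite -Ej reshape_indexK.
case=> c _ ->; apply/val_inj/(etrans (val_config_of r (f c))).
exact: flatten_indexKl.
Qed.

Lemma config_ofK (r : intpart n) : state_of (config_of r) = r.
Proof.
apply: val_inj; apply/ffunP => i; apply: val_inj; rewrite /= state_vecE.
rewrite -[RHS]/(mult r i) -count_parts.
under eq_finset do rewrite team_size_config_of.
have -> : count_mem i.+1 (parts r) =
    count_mem i.+1 [seq nth 0%N (parts r) (val j) | j <- enum 'I_n].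
  rewrite (map_comp _ val) val_enum_ord.
  rewrite -[X in iota 0 X](subnKC (size_parts r)) iotaD map_cat count_cat.
  rewrite add0n map_nth_iota0 // take_size.
  rewrite [X in (_ + X)%N](_ : _ = 0)%N ?addn0 //.
  rewrite count_map; apply/eqP; rewrite -leqn0 leqNgt -has_count.
  apply/hasPn => k; rewrite mem_iota => /andP[le_k _] /=.
  by rewrite nth_default.
by rewrite count_map cardsE cardE size_filter -enumT.
Qed.

Lemma count_codom (T : eqType) (f : 'I_n -> T) (y : T) :
  count_mem y (codom f) = #|[set x | f x == y]|.
Proof. by rewrite codomE count_map cardsE cardE size_filter -enumT. Qed.

Lemma perm_of_codom (T : eqType) (f g : 'I_n -> T) :
  perm_eq (codom f) (codom g) -> exists s : {perm 'I_n}, forall x, g (s x) = f x.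
Proof.
move=> fg; have /tuple_permP[s E] : perm_eq (codom f) (mktuple g).
  by rewrite /= -codomE.
exists s => x; have ltx : (x < size (enum 'I_n))%N by rewrite size_enum_ord.
have := congr1 (fun u => nth (f x) u x) E.
by rewrite codomE (nth_map x) // nth_ord_enum nth_mktuple tnth_mktuple.
Qed.

Lemma state_of_relabel (A B : config n) (s t : {perm 'I_n}) :
  (forall x, B (s x) = t (A x)) -> state_of A = state_of B.
Proof.
move=> AB.
have sz j : team_size B (t j) = team_size A j.
  rewrite /team_size -[RHS](card_imset _ (@perm_inj _ s)); congr #|pred_of_set _|.
  apply/setP => y; rewrite -[y](permKV s) mem_imset; last exact: perm_inj.
  by rewrite !inE AB (inj_eq (@perm_inj _ t)).
apply: val_inj; apply/ffunP => i; apply: val_inj; rewrite /= !state_vecE.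
rewrite -[LHS](card_imset _ (@perm_inj _ t)); congr #|pred_of_set _|.
apply/setP => y; rewrite -[y](permKV t) mem_imset; last exact: perm_inj.
by rewrite !inE sz.
Qed.

Lemma relabel_of_state_of (A B : config n) : state_of A = state_of B ->
  exists s t : {perm 'I_n}, forall x, B (s x) = t (A x).
Proof.
move=> /(congr1 val)/= AB.
have pos m : (0 < m)%N -> count_mem m (codom (team_size A)) =
                         count_mem m (codom (team_size B)).
  case: m => // m _; case: (ltnP m n) => [ltm|lem].
    by rewrite !count_codom -!(state_vecE _ (Ordinal ltm)) AB.
  rewrite !count_codom !eq_card0 // => j; rewrite !inE.
    by apply/negbTE; rewrite neq_ltn ltnS (leq_trans (team_size_le _ _)).
  by apply/negbTE; rewrite neq_ltn ltnS (leq_trans (team_size_le _ _)).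
have tot (C : config n) : (count_mem 0 (codom (team_size C)) +
    \sum_(i < n) state_vec C i = n)%N.
  rewrite count_codom; under eq_bigr do rewrite state_vecE -sum1dep_card.
  rewrite -sum1dep_card (exchange_big_dep xpredT) //= big_mkcond -big_split /=.
  rewrite -[RHS]card_ord -sum1_card; apply: eq_bigr => j _.
  case E: (team_size C j) => [|m]; first by rewrite big_pred0_eq.
  have lt_mn : (m < n)%N by rewrite -E team_size_le.
  by rewrite (big_pred1 (Ordinal lt_mn)) // => i; rewrite eqSS eq_sym.
have /perm_of_codom[t Et] : perm_eq (codom (team_size A)) (codom (team_size B)).
  apply/allP => m _ /=; apply/eqP; case: m => [|m]; last exact: pos.
  apply: (@addIn (\sum_(i < n) state_vec A i)%N); rewrite /= tot.
  by rewrite AB tot.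
have /perm_of_codom[s Es] : perm_eq (codom (fun x => t (A x))) (codom B).
  apply/allP => j _ /=; apply/eqP; rewrite !count_codom.
  rewrite -[RHS]/(team_size B j) -[in RHS](permKV t j) Et.
  apply: eq_card => x; rewrite !inE -[in LHS](permKV t j).
  by rewrite (inj_eq perm_inj).
by exists s, t.
Qed.

(* The transition probabilities do not depend on the configuration chosen to
   represent a state, so the partition process is indeed a Markov chain. *)
Lemma trans_state_of (R : realType) (A : config n) (s : intpart n) :
  trans R (state_of A) s =
  #|[set wl : 'I_n * 'I_n | (wl.1 != wl.2) && (state_of (play A wl) == s)]|%:R
  / #|[set wl : 'I_n * 'I_n | wl.1 != wl.2]|%:R.
Proof.
have [u [t E]] := relabel_of_state_of (esym (config_ofK (state_of A))).
pose f (p : 'I_n * 'I_n) := (u p.1, u p.2).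
have f_inj : injective f.
  by move=> [a b] [c d] [] /perm_inj-> /perm_inj->.
rewrite /trans; move: (config_of _) E => B E; congr (_%:R / _); rewrite -[RHS](card_imset _ f_inj).
congr #|pred_of_set _|; apply/setP => -[a b].
rewrite -[a](permKV u) -[b](permKV u).
set c := (u^-1)%g a; set d := (u^-1)%g b.
rewrite -[(u c, u d)]/(f (c, d)) mem_imset // !inE /= (inj_eq perm_inj).
congr (_ && (_ == s)); symmetry; apply: (state_of_relabel (s := u) (t := t)) => x.
by rewrite !ffunE /= (inj_eq perm_inj); case: eqP => _; rewrite E.
Qed.

End Lumpability.

(* Probability that X_0 = x_0, ..., X_k = x_k for the chain X with initial
   distribution [mu]. *)
Definition path_prob (R : realType) (n : nat) (mu : intpart n -> R) (k : nat)
    (x : {ffun 'I_k.+1 -> intpart n}) : R :=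
  mu (x ord0) * \prod_(i < k) trans R (x (inord i)) (x (inord i.+1)).

(* The chain is in [s] at time k and outside of Stage t at all times < k. *)
Definition enters_at (n t k : nat) (s : intpart n)
    (x : {ffun 'I_k.+1 -> intpart n}) : bool :=
  (x ord_max == s) &&
  [forall i : 'I_k.+1, (i < k)%N ==> (x i \notin stage n t)].

(* Probability that a state of Stage t is reached and that the first such state
   is [s] (for s in Stage t), by summing over the time k of first entrance. *)
Definition first_entrance_prob (R : realType) (n : nat) (mu : intpart n -> R)
    (t : nat) (s : intpart n) : R :=
  limn (series (fun k : nat =>
    \sum_(x : {ffun 'I_k.+1 -> intpart n} | enters_at t s x) path_prob mu x)).

Definition stage_distr (R : realType) (n t : nat) (v : 'rV[R]_#|stage n t|)
    (r : intpart n) : R :=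
  \sum_(j < #|stage n t| | enum_val j == r) v 0 j.

Definition landing_step (R : realType) (n t : nat)
    (v : 'rV[R]_#|stage n t.+1|) : 'rV[R]_#|stage n t| :=
  \row_j first_entrance_prob (stage_distr v) t (enum_val j).

(* [landing_rec R n d t] is the landing vector of Stage t when n = t + d. *)
Fixpoint landing_rec (R : realType) (n d : nat) :
    forall t : nat, 'rV[R]_#|stage n t| :=
  match d with
  | 0 => fun t => const_mx 1
  | d'.+1 => fun t => landing_step (landing_rec R n d' t.+1)
  end.

Definition landing (R : realType) (n t : nat) : 'rV[R]_#|stage n t| :=
  landing_rec R n (n - t) t.

Definition mcoef (R : realType) (n t : nat) (r : intpart n) : R :=
  (t`!)%:R / \prod_(i < n) ((mult r i)`!)%:R.

Definition uvec (R : realType) (n t : nat) : 'rV[R]_#|stage n t| :=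
  \row_j mcoef R t (enum_val j).

(* Main.v *)
Require Import Defs.
From HB Require Import structures.
From mathcomp Require Import all_boot all_order all_fingroup all_algebra.
From mathcomp Require Import all_classical all_reals all_analysis.
From mathcomp Require Import ring zify.
Import Order.TTheory GRing.Theory Num.Theory.
Import numFieldNormedType.Exports.
Local Open Scope ring_scope.
Set Implicit Arguments.
Unset Strict Implicit.
Unset Printing Implicit Defensive.

(* Give a configuration of labelled teams the product of the factorials of its
   team sizes as weight, and a partition the total weight of its configurations.
   Moving one player from team i to team j multiplies the weight by
   (a_j + 1) / a_i, so the inflow into a configuration is easily summed: on
   Stage t the weights form a left eigenvector of the transitions within the
   stage, with eigenvalue 1 - t(t-1) / (n(n-1)), and the inflow from Stage t+1
   into Stage t is again proportional to the weights.  Summing a geometric series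
   over the entrance time, the weights propagate from one landing vector to the
   next.  Two multinomial counts (size functions with given multiplicities, and
   configurations with a given size function) show that the weight of r in
   Stage t is m_r up to a factor depending only on n and t. *)

(** * Counting functions with prescribed fibre sizes *)

Definition ffun_insert (T : Type) (n : nat) (h : 'I_n.+1) (y : T)
    (g : {ffun 'I_n -> T}) : {ffun 'I_n.+1 -> T} :=
  [ffun x => oapp g y (unlift h x)].

Lemma ffun_insert_lift (T : Type) (n : nat) (h : 'I_n.+1) (y : T)
    (g : {ffun 'I_n -> T}) (i : 'I_n) :
  ffun_insert h y g (lift h i) = g i.
Proof. by rewrite ffunE liftK. Qed.

Lemma ffun_insert_id (T : Type) (n : nat) (h : 'I_n.+1) (y : T)
    (g : {ffun 'I_n -> T}) :
  ffun_insert h y g h = y.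
Proof. by rewrite ffunE unlift_none. Qed.

(** Used with [h = ord0] to count functions by induction on the domain, and with [h = ord_max] to
    split off the last state of a path. *)
Lemma big_ffun_insert (S : Type) (idx : S) (op : Monoid.com_law idx)
    (J : finType) (n : nat) (h : 'I_n.+1) (F : {ffun 'I_n.+1 -> J} -> S) :
  \big[op/idx]_f F f =
  \big[op/idx]_(y : J) \big[op/idx]_(g : {ffun 'I_n -> J}) F (ffun_insert h y g).
Proof.
rewrite pair_big /=.
rewrite (reindex (fun p : J * {ffun 'I_n -> J} => ffun_insert h p.1 p.2)) //.
exists (fun f : {ffun 'I_n.+1 -> J} => (f h, [ffun i : 'I_n => f (lift h i)])) =>
    [[y g] _ | f _] /=.
  congr (_, _); first by rewrite ffun_insert_id.
  by apply/ffunP => i; rewrite ffunE ffun_insert_lift.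
apply/ffunP => x; rewrite ffunE.
by case: unliftP => [i|] -> //=; rewrite ffunE.
Qed.

Definition fiber_size (J : finType) (n : nat) (f : {ffun 'I_n -> J}) (j : J) : nat :=
  #|[set x | f x == j]|.

Lemma fiber_size_insert (J : finType) (n : nat) (h : 'I_n.+1) (y : J)
    (g : {ffun 'I_n -> J}) (j : J) :
  fiber_size (ffun_insert h y g) j = ((y == j) + fiber_size g j)%N.
Proof.
rewrite /fiber_size -!sum1dep_card !(big_mkcond (fun x => _ == j)) /=.
rewrite (bigD1_ord h) //= ffun_insert_id; congr (_ + _)%N.
by apply: eq_bigr => i _; rewrite ffun_insert_lift.
Qed.

(** The multinomial coefficient in division-free form. The induction conditions on the value [y] at
    [ord0], which leaves a function with one point fewer over [y]. *)
Lemma card_fiber_size (J : finType) (n : nat) (c : J -> nat) :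
  (\sum_j c j = n)%N ->
  ((\sum_(f : {ffun 'I_n -> J} | [forall j, fiber_size f j == c j]) 1)
     * \prod_j (c j)`! = n`!)%N.
Proof.
elim: n c => [|n IHn] c sum_c.
  have c0 j : c j = 0%N.
    by apply/eqP; rewrite -leqn0 -sum_c (bigD1 j) //= leq_addr.
  rewrite [X in (_ * X)%N]big1 => [|j _]; last by rewrite c0.
  rewrite (big_pred1 (ffun0 (card_ord 0))) // => f.
  have -> : f = ffun0 (card_ord 0) by apply/ffunP => -[].
  rewrite /= eqxx; apply/forallP => j; rewrite c0 /fiber_size cards_eq0.
  by apply/eqP/setP => -[].
rewrite big_mkcond (big_ffun_insert _ ord0) /= big_distrl /=.
(* Writing [n.+1] as the sum of the [c y] turns both sides into sums over [y], which are compared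
   term by term. *)
rewrite factS -[X in (X * _)%N]sum_c big_distrl /=.
apply: eq_bigr => y _; rewrite -big_mkcond /=.
case cy: (c y) => [|m].
  rewrite mul0n big_pred0 ?mul0n // => g; apply/negbTE/forallPn.
  by exists y; rewrite fiber_size_insert eqxx cy.
pose c' j := if j == y then m else c j.
have sum_c' : (\sum_j c' j = n)%N.
  apply: succn_inj; rewrite -sum_c (bigD1 y) // [RHS](bigD1 y) //= cy /c' eqxx addSn.
  by congr (_ + _).+1; apply: eq_bigr => j /negbTE->.
rewrite -(IHn _ sum_c') (bigD1 y) // [in RHS](bigD1 y) //= cy factS {2}/c' eqxx.
rewrite (eq_bigl (fun f : {ffun 'I_n -> J} => [forall j, fiber_size f j == c' j])); last first.
  move=> g; apply: eq_forallb => j; rewrite fiber_size_insert /c' (eq_sym y).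
  by case: (eqVneq j y) => [->|_]; rewrite ?cy.
rewrite (eq_bigr (fun j => (c' j)`!)) => [|j /negbTE yj]; last by rewrite /c' yj.
by rewrite -mulnA mulnCA.
Qed.

(** * Weights of configurations and the total weight of a partition *)

Definition weight (n : nat) (A : config n) : nat := (\prod_j (team_size A j)`!)%N.

(** The finite codomain allows [card_fiber_size] to count the possible size functions too. *)
Definition size_fun (n : nat) (A : config n) : {ffun 'I_n -> 'I_n.+1} :=
  [ffun j => inord (team_size A j)].

Lemma val_size_fun (n : nat) (A : config n) (j : 'I_n) :
  size_fun A j = team_size A j :> nat.
Proof. by rewrite ffunE inordK // ltnS team_size_le. Qed.

Lemma nparts_state_of (n : nat) (A : config n) :
  nparts (state_of A) = #|[set j | (0 < team_size A j)%N]|.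
Proof.
rewrite /nparts; under eq_bigr do rewrite /mult /= state_vecE -sum1dep_card.
rewrite -sum1dep_card (exchange_big_dep xpredT) //= [RHS]big_mkcond /=.
apply: eq_bigr => j _.
case E: (team_size A j) => [|m]; first by rewrite big_pred0_eq.
have lt_mn : (m < n)%N by rewrite -E team_size_le.
by rewrite (big_pred1 (Ordinal lt_mn)) // => i; rewrite eqSS eq_sym.
Qed.

Lemma nparts_le (n : nat) (r : intpart n) : (nparts r <= n)%N.
Proof.
by rewrite -(config_ofK r) nparts_state_of (leq_trans (max_card _)) ?card_ord.
Qed.

(* The value [0] counts the empty teams. *)
Definition mult0 (n : nat) (s : intpart n) (v : 'I_n.+1) : nat :=
  oapp (mult s) (n - nparts s)%N (unlift ord0 v).

Lemma sum_mult0 (n : nat) (s : intpart n) : (\sum_v mult0 s v = n)%N.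
Proof.
rewrite big_ord_recl {1}/mult0 unlift_none /=.
under eq_bigr do rewrite /mult0 liftK /=.
by rewrite subnK // nparts_le.
Qed.

Lemma sum_val_mult0 (n : nat) (s : intpart n) : (\sum_(v < n.+1) v * mult0 s v = n)%N.
Proof.
rewrite big_ord_recl mul0n add0n -[RHS](eqP (valP s)).
by apply: eq_bigr => i _; rewrite /mult0 liftK /=.
Qed.

Lemma state_of_eq (n : nat) (A : config n) (s : intpart n) :
  (state_of A == s) = [forall v, fiber_size (size_fun A) v == mult0 s v].
Proof.
have fiberE v : fiber_size (size_fun A) v = #|[set j | team_size A j == v]|.
  by apply: eq_card => j; rewrite !inE -val_eqE /= val_size_fun.
apply/eqP/forallP => [<- v | sizes].
  rewrite fiberE /mult0; apply/eqP; case: unliftP => [i|] -> /=.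
    by rewrite /mult /= state_vecE.
  have := cardsC [set j | (0 < team_size A j)%N].
  rewrite nparts_state_of card_ord => /(congr1 (subn^~ #|[set j | 0 < team_size A j]|%N)).
  by rewrite addKn => <-; apply: eq_card => j; rewrite !inE -leqNgt leqn0.
apply: val_inj; apply/ffunP => i; apply: val_inj; rewrite /= state_vecE.
by have := sizes (lift ord0 i); rewrite fiberE /mult0 liftK => /eqP.
Qed.

(** Two multinomial counts. There are n! / (prod of [(mult0 s v)!]) size functions [a] in state [s];
    each comes from n! / (prod of [(a j)!]) configurations, all of weight prod of [(a j)!], hence
    contributes exactly n!. *)
Lemma weight_state (n : nat) (s : intpart n) :
  ((\sum_(A | state_of A == s) weight A) * ((n - nparts s)`! * \prod_i (mult s i)`!)
     = n`! * n`!)%N.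
Proof.
have -> : ((n - nparts s)`! * \prod_i (mult s i)`! = \prod_v (mult0 s v)`!)%N.
  rewrite big_ord_recl {1}/mult0 unlift_none; congr (_ * _)%N.
  by apply: eq_bigr => i _; rewrite /mult0 liftK.
rewrite -[X in (_ = _ * X)%N](card_fiber_size (sum_mult0 s)) mulnA; congr (_ * _)%N.
rewrite big_distrr /= (partition_big (@size_fun n)
  (fun a => [forall v, fiber_size a v == mult0 s v])) /=; last first.
  by move=> A; rewrite state_of_eq.
apply: eq_bigr => a /forallP a_fib; rewrite muln1.
have sum_a : (\sum_j a j = n)%N.
  rewrite -[RHS](sum_val_mult0 s) (partition_big a xpredT) //=.
  apply: eq_bigr => v _; rewrite -(eqP (a_fib v)) mulnC -sum_nat_const.
  by apply: eq_big => [j|j /eqP->]; rewrite ?inE.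
rewrite -(card_fiber_size sum_a) big_distrl /=; apply: eq_big => [A|A].
  rewrite state_of_eq; apply/andP/forallP => [[_ /eqP<-] j | A_fib].
    by rewrite val_size_fun.
  have E : size_fun A = a.
    by apply/ffunP => j; apply/val_inj; rewrite /= val_size_fun; apply/eqP/A_fib.
  by rewrite E; split=> //; apply/forallP.
rewrite mul1n => /andP[_ /eqP<-]; apply: eq_bigr => j _.
by rewrite val_size_fun.
Qed.

(** * Undoing one play: the loser is put back on an earlier team *)

Definition move_to (n : nat) (B : config n) (l j : 'I_n) : config n :=
  [ffun x => if x == l then j else B x].

Lemma team_size_move_to (n : nat) (B : config n) (l j k : 'I_n) :
  (team_size (move_to B l j) k + (B l == k) = team_size B k + (j == k))%N.
Proof.
rewrite /team_size -!sum1dep_card !(big_mkcond (fun x => _ == k)) /=.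
rewrite (bigD1 l) // [in RHS](bigD1 l) //= ffunE eqxx.
rewrite (eq_bigr (fun x => if B x == k then 1 else 0)%N) => [|x /negbTE xl].
  by case: (j == k); case: (B l == k); rewrite /= ?add0n ?addn0 ?addn1 ?add1n.
by rewrite ffunE xl.
Qed.

Lemma team_size_gt0 (n : nat) (B : config n) (l : 'I_n) : (0 < team_size B (B l))%N.
Proof. by apply/card_gt0P; exists l; rewrite inE. Qed.

(** Only two factorials change: that of the team [B l] loses its top factor, and that of [j] gains
    one. *)
Lemma weight_move_to (n : nat) (B : config n) (l j : 'I_n) : j != B l ->
  (weight (move_to B l j) * team_size B (B l) = weight B * (team_size B j).+1)%N.
Proof.
move=> jBl; have szl := team_size_move_to B l j (B l).
have szj := team_size_move_to B l j j.
rewrite eqxx (negbTE jBl) addn1 addn0 in szl.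
rewrite eqxx eq_sym (negbTE jBl) addn1 addn0 in szj.
rewrite /weight (bigD1 (B l)) // [in RHS](bigD1 (B l)) //=.
rewrite (bigD1 j) // [in RHS](bigD1 j) //= -szl szj !factS.
rewrite (eq_bigr (fun k => (team_size B k)`!)) => [|k /andP[kBl kj]]; last first.
  have := team_size_move_to B l j k.
  by rewrite eq_sym (negbTE kBl) eq_sym (negbTE kj) !addn0 => ->.
by rewrite !mulnA; lia.
Qed.

Lemma nparts_move_to (n : nat) (B : config n) (l j : 'I_n) :
  (1 < team_size B (B l))%N ->
  nparts (state_of (move_to B l j)) = ((team_size B j == 0) + nparts (state_of B))%N.
Proof.
move=> szBl; rewrite !nparts_state_of.
have -> : [set k | (0 < team_size (move_to B l j) k)%N] =
          j |: [set k | (0 < team_size B k)%N].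
  apply/setP => k; rewrite !inE; have := team_size_move_to B l j k; move: szBl.
  case: (eqVneq j k) => [->|jk]; case: (eqVneq (B l) k) => [->|_] /=; lia.
by rewrite cardsU1 inE -leqNgt leqn0.
Qed.

(* Both sides carry an extra term for the position where the loser stays, so as
   to avoid truncated subtraction. *)
Lemma sum_move_to (n tau : nat) (B : config n) (l : 'I_n) :
  (1 < team_size B (B l))%N ->
  let p := nparts (state_of B) in
  ((\sum_(j | nparts (state_of (move_to B l j)) == tau) weight (move_to B l j))
     * team_size B (B l) + weight B * (p == tau)
   = weight B * ((p == tau) * (n + p) + (p.+1 == tau) * (n - p)))%N.
Proof.
move=> szBl p.
(* The right side is spread over the teams: a nonempty [j] keeps [p] parts and contributes its size
   plus 1, an empty [j] creates a part and contributes 1. *)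
have -> : ((p == tau) * (n + p) + (p.+1 == tau) * (n - p) =
    \sum_j ((p == tau) * (team_size B j + (0 < team_size B j)) +
            (p.+1 == tau) * (team_size B j == 0)))%N.
  rewrite big_split /= -!big_distrr /= big_split /= sum_team_size.
  have Ep : (\sum_j (0 < team_size B j) = p)%N.
    rewrite /p nparts_state_of -sum1dep_card [RHS]big_mkcond /=.
    by apply: eq_bigr => j _; case: (0 < _)%N.
  rewrite Ep; congr (_ + _ * _)%N.
  rewrite -[X in (X - _)%N](card_ord n) -sum1_card -Ep -sumnB => [|j _].
    by apply: eq_bigr => j _; case: (team_size B j).
  by case: (0 < _)%N.
(* The term [j = B l] gives back [B] and absorbs the extra summand. *)
rewrite big_mkcond (bigD1 (B l)) //= [in RHS](bigD1 (B l)) //=.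
rewrite mulnDl mulnDr addnAC; congr (_ + _)%N.
  have -> : move_to B l (B l) = B.
    by apply/ffunP => x; rewrite ffunE; case: eqP => // ->.
  rewrite -/p (ltnW szBl); case: (p == tau) => /=; lia.
rewrite big_distrl big_distrr /=; apply: eq_bigr => j jBl.
rewrite nparts_move_to // -/p; have := weight_move_to jBl.
case: (team_size B j) => [|m] /=; rewrite ?add1n ?add0n.
  by move=> E; case: (_ == tau); rewrite ?mul0n ?muln0 ?E //; lia.
by move=> E; case: (p == tau); rewrite ?mul0n ?muln0 ?E //=; lia.
Qed.

Lemma sum_play_eq (n : nat) (F : config n -> nat) (P : pred (config n))
    (B : config n) (w l : 'I_n) : w != l ->
  (\sum_(A | P A && (play A (w, l) == B)) F A =
   (B l == B w) * \sum_(j | P (move_to B l j)) F (move_to B l j))%N.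
Proof.
move=> wl; case: (eqVneq (B l) (B w)) => [Elw|neq_lw]; last first.
  rewrite mul0n big_pred0 // => A; apply/negbTE/negP => /andP[_ /eqP E].
  by move/eqP: neq_lw; apply; rewrite -E !ffunE /= eqxx (negbTE wl).
rewrite mul1n (partition_big (fun A : config n => A l) (fun j => P (move_to B l j))) /=.
  apply: eq_bigr => j Pj; apply: big_pred1 => A /=.
  apply/andP/eqP => [[/andP[_ /eqP<-] /eqP Al] | ->].
    by apply/ffunP => x; rewrite !ffunE /=; case: eqP => // ->.
  rewrite Pj ffunE eqxx; split=> //=; apply/eqP/ffunP => x.
  by rewrite !ffunE /= (negbTE wl); case: eqP => // ->.
move=> A /andP[PA /eqP E]; have <- // : A = move_to B l (A l).
by apply/ffunP => x; rewrite -E !ffunE /=; case: eqP => // ->.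
Qed.

(** The sum is reorganized by the outcome [B] and the loser [l]. The possible winners are the
    teammates of [l] in [B], whence the factor [(team_size B (B l)).-1]. *)
Lemma sum_weight_play (n tau : nat) (s : intpart n) :
  (\sum_(A | nparts (state_of A) == tau)
     weight A * #|[set wl : 'I_n * 'I_n | (wl.1 != wl.2) && (state_of (play A wl) == s)]|
   = \sum_(B | state_of B == s) \sum_l (team_size B (B l)).-1 *
       \sum_(j | nparts (state_of (move_to B l j)) == tau) weight (move_to B l j))%N.
Proof.
transitivity (\sum_(wl : 'I_n * 'I_n | wl.1 != wl.2)
    \sum_(B | state_of B == s)
    \sum_(A | (nparts (state_of A) == tau) && (play A wl == B)) weight A)%N.
  under eq_bigr do rewrite mulnC -sum_nat_const.
  rewrite (exchange_big_dep (fun wl : 'I_n * 'I_n => wl.1 != wl.2)) /=; last first.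
    by move=> A wl _; rewrite inE => /andP[].
  apply: eq_bigr => wl neq_wl.
  rewrite (partition_big (fun A => play A wl) (fun B => state_of B == s)) /=; last first.
    by move=> A; rewrite inE neq_wl => /andP[].
  apply: eq_bigr => B Bs; apply: eq_bigl => A; rewrite inE neq_wl /=.
  by case: (play A wl =P B) => [->|]; rewrite ?andbF ?andbT ?Bs ?andbT.
rewrite exchange_big /=; apply: eq_bigr => B _.
rewrite -(pair_big_dep xpredT (fun w l => w != l)
  (fun w l => \sum_(A | (nparts (state_of A) == tau) && (play A (w, l) == B)) weight A)%N) /=.
rewrite (exchange_big_dep xpredT) //=; apply: eq_bigr => l _.
rewrite (eq_bigr _ (fun w wl => sum_play_eq _ _ B wl)) -big_distrl /=; congr (_ * _)%N.
have -> : team_size B (B l) = (\sum_(w | w != l) (B l == B w)).+1.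
  rewrite /team_size -sum1dep_card big_mkcond (bigD1 l) //= eqxx add1n.
  by congr _.+1; apply: eq_bigr => w _; rewrite eq_sym; case: (_ == _).
by [].
Qed.

(** * Inflow into a partition in one step *)

Section OneStep.
Variables (R : realType) (n : nat).
Implicit Types (A B : config n) (s : intpart n).

Definition state_weight s : R := \sum_(A : config n | state_of A == s) (weight A)%:R.

(** If the loser ends on a team of size a, [sum_move_to] gives 1/a times a quantity independent of
    the loser, and there are a - 1 winners. Summed over all players, (a - 1)/a yields [n - p]. *)
Lemma sum_state_weight_trans (tau : nat) s : let p := nparts s in
  \sum_(r | nparts r == tau) state_weight r * trans R r s =
  state_weight s * ((p == tau)%:R * (n - p)%:R * (n%:R + p%:R - 1)
                    + (p.+1 == tau)%:R * (n - p)%:R ^+ 2)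
    / #|[set wl : 'I_n * 'I_n | wl.1 != wl.2]|%:R.
Proof.
move=> p; set N := #|_|%:R.
transitivity (((\sum_(A | nparts (state_of A) == tau) weight A *
   #|[set wl : 'I_n * 'I_n | (wl.1 != wl.2) && (state_of (play A wl) == s)]|)%N)%:R / N : R).
  rewrite natr_sum mulr_suml [RHS](partition_big (@state_of n) (fun r => nparts r == tau)) //=.
  apply: eq_bigr => r tr; rewrite /state_weight mulr_suml.
  apply: eq_big => [A|A /eqP<-].
    by case: eqP => [->|]; rewrite ?tr ?andbF.
  by rewrite trans_state_of natrM mulrA.
rewrite sum_weight_play natr_sum; congr (_ / _); rewrite /state_weight mulr_suml.
apply: eq_bigr => B /eqP Bs; set K := (X in _ * X); rewrite natr_sum.
transitivity (\sum_l ((weight B)%:R * ((p == tau)%:R * (n%:R + p%:R - 1)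
  + (p.+1 == tau)%:R * (n - p)%:R)) * ((team_size B (B l)).-1%:R / (team_size B (B l))%:R) : R).
  apply: eq_bigr => l _; have := team_size_gt0 B l.
  have := @sum_move_to n tau B l.
  (* A player alone on a team cannot just have lost: the term vanishes, and [sum_move_to] is needed
     only for sizes above 1. *)
  case: (team_size B (B l)) => // -[|m]; first by rewrite mul0n !mul0r mulr0.
  rewrite Bs -/p => /(_ isT) /(congr1 (fun k => k%:R : R)) + _.
  rewrite /= !(natrM, natrD) natr_sum => E; rewrite mulrCA [LHS]mulrC.
  have nz : m.+2%:R != 0 :> R by rewrite pnatr_eq0.
  apply: (mulIf nz); rewrite /= -!mulrA mulVf // mulr1.
  rewrite mulrCA; congr (_ * _).
  by rewrite -[LHS](addrK ((weight B)%:R * (p == tau)%:R)) E; ring.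
rewrite -mulr_sumr.
(* The members of a team of size a contribute (a - 1)/a each, so a - 1 together. *)
have -> : \sum_l ((team_size B (B l)).-1%:R / (team_size B (B l))%:R) = (n - p)%:R :> R.
  rewrite (partition_big B xpredT) //=.
  transitivity (\sum_j (team_size B j).-1%:R : R).
    apply: eq_bigr => j _; under eq_bigr => i /eqP-> do [].
    rewrite sumr_const -[X in _ *+ X]/#|_| -cardsE -/(team_size B j).
    case: (team_size B j) => [|m] //=; rewrite -[LHS]mulr_natr divfK //.
  rewrite -natr_sum; congr _%:R; rewrite -[X in (X - _)%N](sum_team_size B) /p -Bs nparts_state_of.
  rewrite -sum1dep_card [X in (_ - X)%N]big_mkcond -sumnB => [|j _].
    by apply: eq_bigr => j _; case: (team_size B j) => //= m; rewrite subn1.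
  by case: (team_size B j).
rewrite /K; ring.
Qed.
End OneStep.

(** * Total weights of the stages *)

Lemma card_distinct_pairs (n : nat) :
  #|[set wl : 'I_n * 'I_n | wl.1 != wl.2]| = (n * n.-1)%N.
Proof.
rewrite -sum1dep_card -(pair_big_dep xpredT (fun w l : 'I_n => w != l) (fun _ _ => 1%N)) /=.
rewrite (eq_bigr (fun=> n.-1)) => [|w _]; first by rewrite sum_nat_const card_ord.
rewrite sum1dep_card -[in RHS](card_ord n) -cardsT [in RHS](cardsD1 w) inE /=.
by apply: eq_card => l; rewrite !inE andbT eq_sym.
Qed.

Section Totals.
Variables (R : realType) (n : nat).

Definition stage_weight (t : nat) : R := \sum_(s : intpart n | nparts s == t) state_weight R s.

Lemma sum_trans (r : intpart n) : (2 <= n)%N -> \sum_s trans R r s = 1.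
Proof.
move=> n2; rewrite /trans -mulr_suml -natr_sum.
have -> : (\sum_s #|[set wl : 'I_n * 'I_n | (wl.1 != wl.2) &&
    (state_of (play (config_of r) wl) == s)]| = #|[set wl : 'I_n * 'I_n | wl.1 != wl.2]|)%N.
  rewrite -[RHS]sum1dep_card
    (partition_big (fun wl => state_of (play (config_of r) wl)) xpredT) //=.
  by apply: eq_bigr => s _; rewrite sum1dep_card.
by rewrite divff // card_distinct_pairs pnatr_eq0; lia.
Qed.

(** The weight of Stage t+1 is conserved by a step and lands in Stages t+1 and t. Comparing with the
    inflows leaves n(n-1) - (n-t-1)(n+t) = (t+1)t on the left. *)
Lemma stage_weightS (t : nat) : (2 <= n)%N -> (t.+1 <= n)%N ->
  stage_weight t.+1 * (t.+1%:R * t%:R) = stage_weight t * (n - t)%:R ^+ 2.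
Proof.
move=> n2 tn; have N0 : (n * n.-1)%:R != 0 :> R by rewrite pnatr_eq0; lia.
have: \sum_s \sum_(r : intpart n | nparts r == t.+1) state_weight R r * trans R r s =
      stage_weight t.+1.
  rewrite exchange_big /=; apply: eq_bigr => r _.
  by rewrite -mulr_sumr sum_trans // mulr1.
under eq_bigr do rewrite sum_state_weight_trans card_distinct_pairs.
rewrite -mulr_suml => /(canRL (divfK N0)).
under eq_bigr do rewrite mulrDr.
rewrite big_split /=.
have -> : \sum_(s : intpart n) state_weight R s * ((nparts s == t.+1)%:R * (n - nparts s)%:R
     * (n%:R + (nparts s)%:R - 1)) =
    stage_weight t.+1 * ((n - t.+1)%:R * (n%:R + t.+1%:R - 1)) :> R.
  rewrite /stage_weight big_distrl /= [RHS]big_mkcond; apply: eq_bigr => s _ /=.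
  by case: eqP => [->|_]; rewrite ?mul1r // !mul0r mulr0.
have -> : \sum_(s : intpart n) state_weight R s *
    (((nparts s).+1 == t.+1)%:R * (n - nparts s)%:R ^+ 2) =
    stage_weight t * (n - t)%:R ^+ 2 :> R.
  rewrite /stage_weight big_distrl /= [RHS]big_mkcond; apply: eq_bigr => s _ /=.
  by rewrite eqSS; case: eqP => [->|_]; rewrite ?mul1r // !mul0r mulr0.
rewrite !natrB ?(ltnW tn) // natrM -subn1 natrB ?(ltnW n2) // => E.
apply: (addrI (stage_weight t.+1 * ((n%:R - t.+1%:R) * (n%:R + t.+1%:R - 1)))).
by rewrite E; ring.
Qed.

(** Descends from Stage n, where the configuration with every player alone has positive weight;
    [stage_weightS] carries nonvanishing down. *)
Lemma stage_weight_neq0 (d t : nat) : (2 <= n)%N -> (0 < t)%N -> (t + d = n)%N ->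
  stage_weight t != 0.
Proof.
move=> n2; elim: d t => [|d IHd] t t0 tdn.
  pose A : config n := [ffun x => x].
  have tA : nparts (state_of A) == t.
    rewrite -[t]addn0 tdn nparts_state_of -[X in _ == X](card_ord n) -cardsT; apply/eqP.
    apply: eq_card => j; rewrite !inE; apply/card_gt0P.
    by exists j; rewrite inE ffunE.
  rewrite gt_eqF // /stage_weight (bigD1 (state_of A)) //=.
  rewrite ltr_pwDl ?sumr_ge0 // => [|s _]; last exact: sumr_ge0.
  rewrite /state_weight (bigD1 A) //= ltr_pwDl ?sumr_ge0 //.
  by rewrite ltr0n prodn_gt0 // => j; rewrite fact_gt0.
have tn : (t.+1 <= n)%N by rewrite -tdn; lia.
have Zt1 := IHd t.+1 isT (etrans (addSnnS _ _) tdn).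
have tR : t.+1%:R * t%:R != 0 :> R by rewrite mulf_neq0 ?pnatr_eq0 // -lt0n.
have := mulf_neq0 Zt1 tR; rewrite stage_weightS //.
by apply: contraNneq => ->; rewrite mul0r.
Qed.
End Totals.

(** * First entrance into a stage as a geometric series *)

Section Paths.
Variables (R : realType) (n t : nat).

(* [avoiding mu k s] is the probability of being in [s] at time [k] without a
   visit to Stage [t] at the times before [k]. *)
Fixpoint avoiding (mu : intpart n -> R) (k : nat) : intpart n -> R :=
  match k with
  | 0 => mu
  | k'.+1 => fun s => \sum_(r | r \notin stage n t) avoiding mu k' r * trans R r s
  end.

Lemma sum_path_prob (mu : intpart n -> R) (k : nat) (s : intpart n) :
  \sum_(x : {ffun 'I_k.+1 -> intpart n} | enters_at t s x) path_prob mu x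
  = avoiding mu k s.
Proof.
elim: k s => [|k IHk] s.
  rewrite (big_pred1 [ffun=> s]) => [|x].
    by rewrite /path_prob big_ord0 mulr1 ffunE.
  apply/andP/eqP => [[/eqP xs _] | ->].
    by apply/ffunP => i; rewrite ffunE -xs; congr (x _); rewrite !ord1.
  by rewrite ffunE; split=> //; apply/forallP.
rewrite big_mkcond (big_ffun_insert _ ord_max) (bigD1 s) //= [X in _ + X]big1 ?addr0; last first.
  move=> y ys; rewrite big1 // => g _.
  by rewrite /enters_at ffun_insert_id (negbTE ys).
have inordl i : (i < k.+1)%N -> inord i = lift ord_max (inord i : 'I_k.+1) :> 'I_k.+2.
  move=> ik; apply: val_inj; rewrite /= !inordK ?(ltnW ik) //; last exact: leqW.
  by rewrite /bump leqNgt ik.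
(* Once the last state is fixed to be [s], the condition is that the whole prefix [g], its own last
   state included, avoids Stage t. *)
have entersE (g : {ffun 'I_k.+1 -> intpart n}) :
    enters_at t s (ffun_insert ord_max s g) = [forall i, g i \notin stage n t].
  rewrite /enters_at ffun_insert_id eqxx; apply/forallP/forallP => [H i | H i].
    have := H (lift ord_max i); rewrite ffun_insert_lift => /implyP; apply.
    by rewrite lift_max.
  apply/implyP => ik; case: (unliftP ord_max i) => [j|] E; last by rewrite E ltnn in ik.
  by rewrite E ffun_insert_lift.
have pathE (g : {ffun 'I_k.+1 -> intpart n}) :
    path_prob mu (ffun_insert ord_max s g) = path_prob mu g * trans R (g ord_max) s.
  move: (ffun_insert_lift ord_max s g) (ffun_insert_id ord_max s g).
  move: (ffun_insert _ _ _) => x xl xm.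
  have x0 : x ord0 = g ord0 by rewrite -xl; congr (x _); apply: val_inj.
  have xS : x (inord k.+1) = s.
    by rewrite -xm; congr (x _); apply: val_inj; rewrite /= inordK.
  have xk : x (inord k) = g ord_max.
    by rewrite inordl // xl; congr (g _); apply: val_inj; rewrite /= inordK.
  have prodE : \prod_(i < k) trans R (x (inord i)) (x (inord i.+1)) =
               \prod_(i < k) trans R (g (inord i)) (g (inord i.+1)).
    by apply: eq_bigr => i _; rewrite !inordl ?xl ?ltnS ?ltn_ord // ltnW.
  by rewrite /path_prob big_ord_recr /= x0 xS xk prodE; exact: mulrA.
under eq_bigr do rewrite entersE pathE.
rewrite -big_mkcond (partition_big (fun g : {ffun 'I_k.+1 -> intpart n} => g ord_max)
  (fun r => r \notin stage n t)) /=; last by move=> g /forallP.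
apply: eq_bigr => r rt; rewrite -IHk mulr_suml; apply: eq_big => g.
  rewrite /enters_at andbC; case: eqP => //= gr.
  apply/forallP/forallP => [H i | H i]; first by apply/implyP.
  case: (ltnP i k) => ik; first by have /implyP/(_ ik) := H i.
  suff -> : i = ord_max by rewrite gr.
  by apply: val_inj => /=; have := ltn_ord i; lia.
by move=> /andP[_ /eqP->].
Qed.

(** The eigenvalue 1 - (t+1)t / (n(n-1)) of the transitions within Stage t+1. *)
Definition stay_prob : R := (n - t.+1)%:R * (n%:R + t%:R) / (n * n.-1)%:R.

Hypotheses (n2 : (2 <= n)%N) (t0 : (0 < t)%N) (tn : (t < n)%N).
Variable c : R.
Let mu (r : intpart n) : R := if nparts r == t.+1 then c * state_weight R r else 0.

(** Since [mu] lives on Stage t+1, excluding Stage t removes nothing, and the one-step inflow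
    formula applies with [tau = t.+1]. *)
Lemma sum_mu_trans (s : intpart n) :
  \sum_(r | r \notin stage n t) mu r * trans R r s =
  if nparts s == t then c * state_weight R s * ((n - t)%:R ^+ 2 / (n * n.-1)%:R)
  else stay_prob * mu s.
Proof.
transitivity (c * \sum_(r | nparts r == t.+1) state_weight R r * trans R r s).
  rewrite mulr_sumr big_mkcond [RHS]big_mkcond; apply: eq_bigr => r _ /=.
  rewrite inE /mu; case: eqP => [->|_] /=; first by rewrite ltn_eqF.
  by case: eqP; rewrite ?mul0r // mulrA.
rewrite sum_state_weight_trans card_distinct_pairs eqSS /mu /stay_prob.
case: (eqVneq (nparts s) t) => [->|_].
  by rewrite ltn_eqF //= !mul0r add0r mul1r !mulrA.
case: eqP => [->|_]; last by rewrite !mul0r addr0 mulr0 mul0r !mulr0.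
rewrite mul0r addr0 mul1r; ring.
Qed.

Lemma avoiding_mu (k : nat) (s : intpart n) : nparts s != t ->
  avoiding mu k s = stay_prob ^+ k * mu s.
Proof.
elim: k s => [|k IHk] s st; first by rewrite expr0 mul1r.
rewrite /= (eq_bigr (fun r => stay_prob ^+ k * (mu r * trans R r s))) => [|r rt].
  by rewrite -mulr_sumr sum_mu_trans (negbTE st) exprSr mulrA.
by rewrite IHk ?mulrA //; move: rt; rewrite inE.
Qed.

Lemma avoiding_muS (k : nat) (s : intpart n) : nparts s = t ->
  avoiding mu k.+1 s =
  c * state_weight R s * ((n - t)%:R ^+ 2 / (n * n.-1)%:R) * stay_prob ^+ k.
Proof.
move=> st; rewrite /= (eq_bigr (fun r => stay_prob ^+ k * (mu r * trans R r s))) => [|r rt].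
  by rewrite -mulr_sumr sum_mu_trans st eqxx mulrC.
by rewrite avoiding_mu ?mulrA //; move: rt; rewrite inE.
Qed.

Lemma one_sub_stay_prob : 1 - stay_prob = t.+1%:R * t%:R / (n * n.-1)%:R.
Proof.
have N0 : (n * n.-1)%:R != 0 :> R by rewrite pnatr_eq0; lia.
apply: (mulIf N0); rewrite mulrBl mul1r /stay_prob !divfK //.
rewrite natrM natrB // -subn1 natrB ?(ltnW n2) //; ring.
Qed.

(** The entrance probabilities at times 1, 2, ... are geometric with ratio [stay_prob]; dividing by
    [1 - stay_prob] replaces n(n-1) by (t+1)t. *)
Lemma first_entrance_mu (s : intpart n) : nparts s = t ->
  first_entrance_prob mu t s =
  c * state_weight R s * ((n - t)%:R ^+ 2 / (t.+1%:R * t%:R)).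
Proof.
move=> st; have N0 : (n * n.-1)%:R != 0 :> R by rewrite pnatr_eq0; lia.
have lt1 : `|stay_prob| < 1.
  rewrite ger0_norm; last by rewrite /stay_prob !mulr_ge0 ?invr_ge0 // addr_ge0.
  rewrite -subr_gt0 one_sub_stay_prob divr_gt0 ?mulr_gt0 ?ltr0n //; lia.
pose a := c * state_weight R s * ((n - t)%:R ^+ 2 / (n * n.-1)%:R).
have cvg_avoiding :
    (series (fun k => avoiding mu k s) @ \oo --> a * (1 - stay_prob)^-1)%classic.
  (* The shift by one drops the term at time 0, which is zero because [mu] vanishes on Stage t. *)
  rewrite -cvg_shiftS.
  rewrite [X in (X @ _)%classic](_ : _ = series (geometric a stay_prob)).
    exact: cvg_geometric_series.
  apply/funext => k; rewrite /series /= big_nat_recl //=.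
  rewrite {1}/mu st ltn_eqF // add0r; apply: eq_bigr => i _.
  by rewrite -[LHS]/(avoiding mu i.+1 s) avoiding_muS.
rewrite /first_entrance_prob; under eq_fun do rewrite sum_path_prob.
rewrite (cvg_lim _ cvg_avoiding); last exact: Rhausdorff.
by rewrite one_sub_stay_prob /a invf_div -!mulrA mulKf.
Qed.

End Paths.

(** * Landing vectors as normalized weights *)

Lemma nparts_max_inj (n : nat) (r s : intpart n) : nparts r = n -> nparts s = n -> r = s.
Proof.
have mult_eq0 (q : intpart n) (i : 'I_n) : nparts q = n -> (0 < i)%N -> mult q i = 0%N.
  move=> qn i0; have /eqP := valP q.
  (* Subtracting the number of parts, n, from the sum of the parts, also n, leaves the sum of the
     [i * mult q i] equal to 0: all parts have size 1. *)
  under eq_bigr do rewrite mulSn; rewrite big_split /= -/(nparts q) qn.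
  rewrite -[X in _ = X]addn0 => /addnI/eqP; rewrite sum_nat_eq0 => /forallP/(_ i)/=.
  by rewrite muln_eq0 gtn_eqF // => /eqP.
move=> rn sn; apply/val_inj/ffunP => i; apply/val_inj.
rewrite -[LHS]/(mult r i) -[RHS]/(mult s i).
case: (posnP i) => [i0|i0]; last by rewrite !mult_eq0.
have sum1E (q : intpart n) : nparts q = n -> mult q i = n.
  move=> qn; rewrite -[RHS]qn /nparts (bigD1 i) //= big1 ?addn0 // => j ji.
  by rewrite mult_eq0 // lt0n -i0 (inj_eq val_inj).
by rewrite !sum1E.
Qed.

(** Descending induction from the single state of Stage n. With Z_t for [stage_weight R n t],
    [first_entrance_mu] is applied with c = 1/Z_(t+1), and [stage_weightS] turns its factor into
    Z_(t+1)/Z_t. *)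
Lemma landing_recE (R : realType) (n d t : nat) : (2 <= n)%N -> (0 < t)%N ->
  (t + d = n)%N ->
  landing_rec R n d t = \row_j (state_weight R (enum_val j) / stage_weight R n t).
Proof.
move=> n2; elim: d t => [|d IHd] t t0 tdn.
  apply/rowP => j; rewrite !mxE.
  have tn : t = n by rewrite -[t]addn0.
  have jt : nparts (enum_val j) == t by have := enum_valP j; rewrite inE.
  have Zt : stage_weight R n t = state_weight R (enum_val j).
    rewrite /stage_weight (big_pred1 (enum_val j)) // => s /=.
    apply/eqP/eqP => [st|->]; last exact/eqP.
    by apply: nparts_max_inj; rewrite ?st ?(eqP jt).
  by rewrite -Zt divff //; exact: (@stage_weight_neq0 R n 0%N).
have tn : (t < n)%N by rewrite -tdn; lia.
rewrite /= IHd ?addSnnS //; apply/rowP => j; rewrite !mxE.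
set Z := stage_weight R n t.+1.
have Zn0 : Z != 0 by apply: (@stage_weight_neq0 R n d); rewrite // addSnnS.
have Zt0 : stage_weight R n t != 0 by exact: (@stage_weight_neq0 R n d.+1).
have /[!inE] /eqP jt : enum_val j \in stage n t by apply: enum_valP.
(* The sum defining [stage_distr] has one term, at the rank of [r], if [r] is in Stage t+1, and none
   otherwise. *)
have -> : stage_distr (\row_(i < #|stage n t.+1|) (state_weight R (enum_val i) / Z)) =
    (fun r : intpart n => if nparts r == t.+1 then Z^-1 * state_weight R r else 0).
  apply/funext => r; rewrite /stage_distr; case: ifP => rt.
    have rS : r \in stage n t.+1 by rewrite inE.
    rewrite (big_pred1 (enum_rank_in rS r)) => [|i].
      by rewrite mxE enum_rankK_in // mulrC.
    apply/eqP/eqP => [ir|->]; last by rewrite enum_rankK_in.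
    by apply: enum_val_inj; rewrite enum_rankK_in.
  rewrite big_pred0 // => i; apply/negP => /eqP ir.
  by have := enum_valP i; rewrite ir inE rt.
rewrite first_entrance_mu //.
have := @stage_weightS R n t n2 tn; rewrite -/Z => E.
have tR : t.+1%:R * t%:R != 0 :> R by rewrite mulf_neq0 ?pnatr_eq0 // -lt0n.
have -> : (n - t)%:R ^+ 2 / (t.+1%:R * t%:R) = Z / stage_weight R n t.
  by apply/eqP; rewrite eqr_div // E mulrC.
by rewrite [Z^-1 * _]mulrC mulrA divfK.
Qed.

(** A rearrangement of [weight_state]; what matters is that the factor is the same for all states of
    Stage t. *)
Lemma mcoefE (R : realType) (n t : nat) (s : intpart n) : nparts s = t ->
  mcoef R t s = (t`! * (n - t)`!)%:R / (n`! * n`!)%:R * state_weight R s.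
Proof.
move=> st; have := weight_state s; rewrite st.
move=> /(congr1 (fun k => k%:R : R)); rewrite !natrM natr_sum natr_prod.
rewrite /mcoef /state_weight => E.
have fn0 m : m`!%:R != 0 :> R by rewrite pnatr_eq0 -lt0n fact_gt0.
have P0 : \prod_(i < n) (mult s i)`!%:R != 0 :> R.
  by apply/prodf_neq0 => i _.
have S0 : \sum_(A : config n | state_of A == s) (weight A)%:R != 0 :> R.
  apply/eqP => S0; have /eqP := E; rewrite S0 mul0r eq_sym; apply/negP.
  exact: mulf_neq0.
rewrite -E; field.
by rewrite P0 fn0 S0.
Qed.

Theorem theorem5 (R : realType) (n : nat) (hn : (2 <= n)%N)
    (t : nat) (ht : (1 <= t <= n)%N) :
  landing R n t
  = (1 / (uvec R n t *m (const_mx 1 : 'cV[R]_#|stage n t|)) 0 0) *: uvec R n t.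
Proof.
have /andP[t0 tn] := ht.
(* The ratio of m_r to the weight of r from [mcoefE]; it cancels in the normalization. *)
set K : R := (t`! * (n - t)`!)%:R / (n`! * n`!)%:R.
have K0 : K != 0 by rewrite mulf_neq0 ?invr_eq0 // pnatr_eq0 -lt0n muln_gt0 !fact_gt0.
have uE j : uvec R n t 0 j = K * state_weight R (enum_val j).
  by rewrite mxE (@mcoefE R n t) //; have := enum_valP j; rewrite inE => /eqP.
have sum_u : (uvec R n t *m (const_mx 1 : 'cV[R]_#|stage n t|)) 0 0 = K * stage_weight R n t.
  rewrite mxE (eq_bigr (fun j => K * state_weight R (enum_val j))) => [|j _].
    rewrite -mulr_sumr /stage_weight; congr (_ * _).
    rewrite -(big_enum_val (@state_weight R n)) /=.
    by apply: eq_bigl => s; rewrite inE.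
  by rewrite [const_mx 1 _ _]mxE mulr1 uE.
have Z0 : stage_weight R n t != 0 by apply: (@stage_weight_neq0 R n (n - t)); rewrite ?subnKC.
rewrite sum_u /landing landing_recE ?subnKC //; apply/rowP => j.
rewrite mxE [RHS]mxE uE; field.
by rewrite K0 Z0.
Qed.
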